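(* Let $h$ and $m$ be positive definite forms in a Hilbert space $\mathcal{H}$ with common form domain $\mathcal{Q}$, let $\mathbf{H}$ and $\mathbf{M}$ be the selfadjoint operators they define, and suppose that for some $\eta\ge 0$ $$|h(\phi,\psi)-m(\phi,\psi)|\le\eta\sqrt{h[\phi]\,m[\psi]}\qquad\text{for all }\phi,\psi\in\mathcal{Q}.$$ Let $0<D_1<D_2$ be such that the interval $[D_1,D_2]$ is contained in the resolvent sets of both $\mathbf{H}$ and $\mathbf{M}$. Set $Q=E_{\mathbf{H}}(D_1)$, $P=E_{\mathbf{M}}(D_1)$ and assume $\eta<(D_2-D_1)(D_2D_1)^{-1/2}$. Then $$\|P-Q\|\le\frac{\sqrt{D_2D_1}}{D_2-D_1}\,\eta .$$
   Context: A positive definite form is a closed, densely defined symmetric sesquilinear form bounded below by a positive constant times $\|\cdot\|^2$; the operator $\mathbf{H}$ defined by $h$ is the selfadjoint operator with $\mathcal{D}(\mathbf{H}^{1/2})=\mathcal{Q}$ and $h(u,v)=(\mathbf{H}^{1/2}u,\mathbf{H}^{1/2}v)$, and similarly for $m$, $\mathbf{M}$. Notation: $h[\phi]=h(\phi,\phi)$, $m[\psi]=m(\psi,\psi)$. $E_{\mathbf{H}}(\cdot)$, $E_{\mathbf{M}}(\cdot)$ are the right-continuous spectral families, i.e. $E_{\mathbf{H}}(\lambda)$ is the spectral projection of $\mathbf{H}$ for $(-\infty,\lambda]$. The ranges of $P$ and $Q$ may be infinite dimensional. $\|\cdot\|$ is the operator norm. *)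

(* Defs.v *)
From HB Require Import structures.
From mathcomp Require Import all_boot all_order all_algebra.
From mathcomp Require Import sesquilinear complex.
From mathcomp Require Import all_classical all_reals all_analysis.

Set Implicit Arguments.
Unset Strict Implicit.
Unset Printing Implicit Defensive.
Import Order.TTheory GRing.Theory Num.Theory Num.Def.
Import numFieldNormedType.Exports.

Local Open Scope classical_set_scope.
Local Open Scope ring_scope.
Local Open Scope complex_scope.

(* Complex Hilbert spaces.  The inner product is linear in its first argument
   and conjugate-linear in the second one. *)
HB.mixin Record isHilbert (R : realType) V
    of CompleteNormedModule R[i] V := {
  inner : {dot V for (@conjC R[i])} ;
  sqr_norm_inner : forall x : V, `|x| ^+ 2 = inner x x }.

#[short(type="hilbertType")]
HB.structure Definition Hilbert (R : realType) :=
  { V of isHilbert R V & CompleteNormedModule R[i] V }.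

Section Subspaces.
Context {R : realType} {H : hilbertType R}.

Definition is_subspace (D : set H) :=
  D 0 /\ forall (a : R[i]) u v, D u -> D v -> D (a *: u + v).

Definition dense_subspace (D : set H) := is_subspace D /\ closure D = setT.

End Subspaces.

Section Forms.
Context {R : realType} {H : hilbertType R}.
Implicit Types (Q : set H) (h : H -> H -> R[i]).

(* A form with domain [Q] is a total function; its values outside [Q] are
   irrelevant. *)
Definition sesquilinear_on Q h :=
  (forall a u v w, Q u -> Q v -> Q w ->
     h (a *: u + v) w = a * h u w + h v w) /\
  (forall a u v w, Q u -> Q v -> Q w ->
     h w (a *: u + v) = conjC a * h w u + h w v).

Definition symmetric_on Q h :=
  forall u v, Q u -> Q v -> h v u = conjC (h u v).

(* h[u]; real whenever [h] is symmetric and [u] is in its domain. *)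
Definition qform h (u : H) : R := complex.Re (h u u).

Definition closed_form Q h :=
  forall (u_ : nat -> H) (u : H),
    (forall n, Q (u_ n)) ->
    u_ @ \oo --> u ->
    (forall e : R, 0 < e ->
       exists N, forall n m, (N <= n)%N -> (N <= m)%N ->
         `|qform h (u_ n - u_ m)| < e) ->
    Q u /\
    (forall e : R, 0 < e ->
       exists N, forall n, (N <= n)%N -> `|qform h (u_ n - u)| < e).

Record positive_definite_form Q h : Prop := PositiveDefiniteForm {
  pdf_dense : dense_subspace Q ;
  pdf_sesquilinear : sesquilinear_on Q h ;
  pdf_symmetric : symmetric_on Q h ;
  pdf_bounded_below : exists2 c : R, 0 < c &
    forall u, Q u -> c * complex.Re `|u| ^+ 2 <= qform h u ;
  pdf_closed : closed_form Q h }.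

End Forms.

(* Possibly unbounded linear operators; the values of [op_fun] outside the
   domain are irrelevant. *)
Record operator (R : realType) (H : hilbertType R) := Operator {
  dom : set H ;
  op_fun :> H -> H ;
  dom_subspace : is_subspace dom ;
  op_linear : forall (a : R[i]) u v, dom u -> dom v ->
    op_fun (a *: u + v) = a *: op_fun u + op_fun v }.

Section Operators.
Context {R : realType} {H : hilbertType R}.
Implicit Types (T S : operator H).

(* (v, w) belongs to the graph of the adjoint of T. *)
Definition adjoint_graph T (v w : H) :=
  forall u, dom T u -> inner (T u) v = inner u w.

Definition selfadjoint T :=
  closure (dom T) = setT /\
  forall v w, adjoint_graph T v w <-> dom T v /\ T v = w.

Definition nonnegative T := forall u, dom T u -> 0 <= inner (T u) u.

(* S is the nonnegative selfadjoint square root of T, that is S = T^{1/2}. *)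
Definition is_sqrt S T :=
  [/\ selfadjoint S, nonnegative S,
      dom T = [set u | dom S u /\ dom S (S u)] &
      forall u, dom T u -> T u = S (S u)].

Definition operator_of_form (Q : set H) (h : H -> H -> R[i]) T :=
  selfadjoint T /\
  exists S, [/\ is_sqrt S T, dom S = Q &
    forall u v, Q u -> Q v -> h u v = inner (S u) (S v)].

Definition resolvent_set T : set R[i] :=
  [set z | exists A : {linear H -> H},
    [/\ continuous A,
        forall v, dom T (A v) /\ T (A v) - z *: A v = v &
        forall u, dom T u -> A (T u - z *: u) = u]].

(* Operator norm of an everywhere defined operator, +oo if it is unbounded. *)
Definition opnorm (A : H -> H) : \bar R :=
  ereal_sup [set (complex.Re `|A x|)%:E | x in [set x | `|x| <= 1]].

End Operators.

(* Right-continuous resolutions of the identity. *)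
Record spectral_family (R : realType) (H : hilbertType R) := SpectralFamily {
  sf :> R -> H -> H ;
  sf_linear : forall t (a : R[i]) u v, sf t (a *: u + v) = a *: sf t u + sf t v ;
  sf_idem : forall t u, sf t (sf t u) = sf t u ;
  sf_sym : forall t u v, inner (sf t u) v = inner u (sf t v) ;
  sf_mono : forall s t u, s <= t -> sf t (sf s u) = sf s u ;
  sf_right_continuous : forall t u, sf s u @[s --> t^'+] --> sf t u ;
  sf_cvg_ninfty : forall u, sf t u @[t --> -oo] --> (0 : H) ;
  sf_cvg_pinfty : forall u, sf t u @[t --> +oo] --> u }.

Section SpectralDistribution.
Context {R : realType} {H : hilbertType R}.
Implicit Types (E : spectral_family H).

(* t |-> (E(t) u, u) *)
Definition spectral_dist E (u : H) (t : R) : R :=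
  complex.Re (inner (E t u) u).

Lemma spectral_dist_sub E u s t : s <= t ->
  (spectral_dist E u t - spectral_dist E u s)%:C = `|E t u - E s u| ^+ 2.
Proof.
have EE r r' : inner (E r u) (E r' u) = inner (E r' (E r u)) u.
  by rewrite [RHS]sf_sym.
have re r : (spectral_dist E u r)%:C = inner (E r u) u.
  rewrite /spectral_dist RRe_real// -[E r u]sf_idem -EE -sqr_norm_inner.
  by rewrite ger0_real// exprn_ge0.
move=> st; rewrite rmorphB /= !re sqr_norm_inner linearBl !linearBr /=.
rewrite !EE !sf_idem (sf_mono _ _ st).
have -> : inner (E s (E t u)) u = inner (E s u) u.
  by rewrite [LHS]sf_sym [LHS]sf_sym sf_mono// -sf_sym.
by rewrite subrr subr0.
Qed.

Lemma spectral_dist_nd E u : nondecreasing (spectral_dist E u).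
Proof.
move=> s t st; rewrite -subr_ge0 -lecR spectral_dist_sub//.
by rewrite exprn_ge0.
Qed.

Lemma spectral_dist_rc E u : right_continuous (spectral_dist E u).
Proof.
move=> t; apply/(@cvgrPdist_lt _ R^o) => e e0.
have se0 : (0 : R[i]) < (Num.sqrt e)%:C by rewrite ltcR sqrtr_gt0.
have /cvgrPdist_lt/(_ _ se0) := @sf_right_continuous _ _ E t u.
move=> cE; near=> s.
have ts : t <= s by near: s; exact: nbhs_right_ge.
rewrite distrC ger0_norm ?subr_ge0 ?spectral_dist_nd//.
rewrite -ltcR spectral_dist_sub//.
have -> : e%:C = (Num.sqrt e)%:C ^+ 2 by rewrite -rmorphXn /= sqr_sqrtr// ltW.
rewrite ltrXn2r// distrC; near: s.
Unshelve. all: by end_near. Qed.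

HB.instance Definition _ E u := isCumulative.Build R _ R (spectral_dist E u)
  (@spectral_dist_nd E u) (@spectral_dist_rc E u).

(* d(E(t) u, u) *)
Definition spectral_measure E u := lebesgue_stieltjes_measure (spectral_dist E u).

(* T is the integral of t dE(t).  The domain is then dense, so that by
   polarization the quadratic form determines T u for u in the domain. *)
Definition spectral_family_of E (T : operator H) :=
  dom T = [set u | (\int[spectral_measure E u]_t (t ^+ 2)%:E < +oo)%E] /\
  forall u, dom T u ->
    inner (T u) u = (\int[spectral_measure E u]_t t)%:C.

End SpectralDistribution.

(* Main.v *)
Require Import Defs.
From HB Require Import structures.
From mathcomp Require Import all_boot all_order all_algebra.
From mathcomp Require Import sesquilinear complex.
From mathcomp Require Import all_classical all_reals all_analysis.
From mathcomp Require Import measurable_realfun ring lra.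

(** The estimate is the solution of a weak Sylvester equation by iteration.
    Write [Q] for [EH D1] and [P] for [EM D1], and put
    [delta = sqrt (D1 D2) / (D2 - D1) * eta].  It suffices to show that
      [Re (u, v) <= delta |u| |v|]   for [u] in the range of [Q], [P v = 0],
    and the same with the two operators exchanged: [P - Q] is the orthogonal sum
    [P (1 - Q) - (1 - P) Q], so the square of its norm is a sum of two
    terms, one for each of these angles ([rnorm_sfB]).

    If [v = M w], then
      [(u, v) = m(u, w) = h(u, w) + (m - h)(u, w) = (H u, w) + (m - h)(u, w)].
    On the ranges in question [|H u| <= D1 |u|], while the gap of the spectrum
    of [M] gives [|w| <= |v| / D2]; moreover [h[u] <= D1 |u|^2] and
    [m[w] <= |v|^2 / D2].  Hence if [tau] bounds the cosine of the angle of the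
    two ranges, so does [tau D1 / D2 + eta sqrt (D1 D2) / D2]
    ([band_angle_improve]).  The fixed point of this affine contraction is
    [delta], and [tau = 1 + delta] is a bound to start from ([band_angle]).

    The spectral calculus needed here is obtained from the spectral measures on
    the ranges of [E b - E a] for bounded intervals, the bands.  A band lies in the
    domain, since its vectors have spectral measures carried by ]a, b]; the
    quadratic form of the operator lies between [a] and [b] there
    ([band_bounds]); and the operator maps the band to itself, because the
    quadratic form is additive on a vector of the band and a vector orthogonal
    to the band ([band_op]).  Polarization turns bounds of quadratic forms into
    norm bounds ([symmetric_norm_le]).  With this, a resolvent at [t] forces
    [E] to be constant near [t], so [E D1 = E D2] ([resolvent_constant]), and
    [v = M w] is solvable up to arbitrarily small errors by a truncated Neumann
    series ([band_op_range_dense]).  Unbounded spectral intervals are reached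
    by [a -> -oo] and [b -> +oo] ([spectral_angle]). *)

Set Implicit Arguments.
Unset Strict Implicit.
Unset Printing Implicit Defensive.
Import Order.TTheory GRing.Theory Num.Theory.
Import numFieldNormedType.Exports.

Local Open Scope classical_set_scope.
Local Open Scope ring_scope.
Local Open Scope complex_scope.

(** * The real inner product of a complex Hilbert space *)

Section RealStructure.
Context {R : realType} {X : hilbertType R}.
Implicit Types (x y z : X) (a : R).

(** The real part of the inner product makes the space a real inner product
    space with the same norm.  All estimates are carried out there, where the
    order is total. *)
Definition rnorm x : R := complex.Re `|x|.
Definition rinner x y : R := complex.Re (inner x y).

Lemma rnormE x : `|x| = (rnorm x)%:C.
Proof. by rewrite /rnorm RRe_real ?ger0_real. Qed.

Lemma rnorm_ge0 x : 0 <= rnorm x.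
Proof. by rewrite -lecR -rnormE normr_ge0. Qed.

Lemma rnorm_eq0 x : rnorm x = 0 -> x = 0.
Proof. by move=> x0; apply/eqP; rewrite -normr_eq0 rnormE x0. Qed.

Lemma rnormD x y : rnorm (x + y) <= rnorm x + rnorm y.
Proof. by rewrite -lecR rmorphD /= -!rnormE ler_normD. Qed.

Lemma rnormN x : rnorm (- x) = rnorm x.
Proof. by rewrite /rnorm normrN. Qed.

Lemma rnormZ a x : rnorm (a%:C *: x) = `|a| * rnorm x.
Proof.
apply: (@complexI R); rewrite -rnormE normrZ rmorphM /= rnormE normc_def /=.
by rewrite expr0n addr0 sqrtr_sqr.
Qed.

Lemma rinner_conj x y : inner y x = Num.conj (inner x y).
Proof. by rewrite hermC /= expr0 mul1r. Qed.

Lemma rinnerC x y : rinner x y = rinner y x.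
Proof. by rewrite /rinner (rinner_conj y); case: (inner y x). Qed.

Lemma rinnerDl x y z : rinner (x + y) z = rinner x z + rinner y z.
Proof. by rewrite /rinner linearDl raddfD. Qed.

Lemma rinnerZl a x y : rinner (a%:C *: x) y = a * rinner x y.
Proof. by rewrite /rinner linearZl_LR /=; case: (inner x y) => ? ? /=; ring. Qed.

Lemma rinnerNl x y : rinner (- x) y = - rinner x y.
Proof. by rewrite /rinner linearNl raddfN. Qed.

Lemma rinnerDr x y z : rinner x (y + z) = rinner x y + rinner x z.
Proof. by rewrite !(rinnerC x) rinnerDl. Qed.

Lemma rinnerZr a x y : rinner x (a%:C *: y) = a * rinner x y.
Proof. by rewrite !(rinnerC x) rinnerZl. Qed.

Lemma rinnerNr x y : rinner x (- y) = - rinner x y.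
Proof. by rewrite !(rinnerC x) rinnerNl. Qed.

Lemma rinner0l x : rinner 0 x = 0.
Proof. by rewrite /rinner linear0l. Qed.

Definition rinnerE := (rinnerDl, rinnerDr, rinnerNl, rinnerNr, rinnerZl, rinnerZr).

Lemma rinner_sqr x : rinner x x = rnorm x ^+ 2.
Proof. by rewrite /rinner -sqr_norm_inner rnormE -rmorphXn. Qed.

Lemma rinner_le x y : rinner x y <= rnorm x * rnorm y.
Proof.
have [/rnorm_eq0 ->|x0] := eqVneq (rnorm x) 0.
  by rewrite rinner0l mulr_ge0 ?rnorm_ge0.
have [/rnorm_eq0 ->|y0] := eqVneq (rnorm y) 0.
  by rewrite rinnerC rinner0l mulr_ge0 ?rnorm_ge0.
have := sqr_ge0 (rnorm ((rnorm y)%:C *: x - (rnorm x)%:C *: y)).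
rewrite -rinner_sqr !rinnerE (rinnerC y) !rinner_sqr => xy.
have : 0 < 2 * (rnorm x * rnorm y) by rewrite !mulr_gt0// lt_neqAle eq_sym ?x0 ?y0 rnorm_ge0.
move=> /ler_pM2l <-; rewrite -subr_ge0; move: xy; congr (0 <= _); ring.
Qed.

End RealStructure.

(** * Stieltjes measures and the first moment *)

Section StieltjesMeasure.
Context {R : realType}.
Implicit Types (f g h : cumulative R R) (a b : R).
Local Notation lsm := lebesgue_stieltjes_measure.

Lemma stieltjes_itv f a b : a <= b -> lsm f `]a, b]%classic = (f b - f a)%:E.
Proof.
move=> ab; rewrite /lebesgue_stieltjes_measure /measure_extension.
by rewrite measurable_mu_extE/= ?wlength_itv_bnd//; exact: is_ocitv.
Qed.

Lemma stieltjes_itv0 f a b : (a <= b -> f a = f b) ->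
  lsm f `]a, b]%classic = 0%E.
Proof.
move=> fab; have [ab|ba] := leP a b; first by rewrite stieltjes_itv ?fab ?subrr.
by rewrite set_itv_ge ?measure0// bnd_simp -leNgt ltW.
Qed.

(** Both sides are measures that agree on half-open intervals, where they are
    differences of distribution functions. *)
Lemma stieltjes_add f g h :
  (forall t, f t = g t + h t) -> forall A : set (measurableTypeR R), measurable A ->
  lsm f A = measure_add (lsm g) (lsm h) A.
Proof.
move=> fE A mA.
apply: (@lebesgue_stieltjes_measure_unique R f
  (measure_add (lsm g) (lsm h))) => // _ [[a b] _ <-] /=.
rewrite [RHS]measure_addE; have [ab|ba] := leP a b.
  have -> : lsm f `]a, b]%classic = ((g b - g a)%:E + (h b - h a)%:E)%E.
    by rewrite stieltjes_itv// !fE -EFinD; congr (_%:E); ring.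
  by congr +%E; exact/esym/stieltjes_itv.
by rewrite set_itv_ge ?measure0 ?adde0// bnd_simp -leNgt ltW.
Qed.

Lemma stieltjes_null f a b :
  (forall t, t <= a -> f t = f a) -> (forall t, b <= t -> f t = f b) ->
  lsm f (~` `]a, b]%classic) = 0%E.
Proof.
move=> fa fb; apply/negligibleP; first exact/measurableC.
rewrite setCitv /= itvNybndEbigcup itv_bndy_bigcup_BRight.
apply: negligibleU; apply: negligible_bigcup => n; apply/negligibleP => //.
  by apply: stieltjes_itv0 => /fa.
by apply: stieltjes_itv0 => /fb.
Qed.

End StieltjesMeasure.

Section StieltjesIntegral.
Context {R : realType} (f : cumulative R R).
Local Notation mu := (lebesgue_stieltjes_measure f).

Lemma stieltjes_itv_lty (a b : R) : (mu `]a, b]%classic < +oo)%E.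
Proof.
have [ab|ba] := leP a b; first by rewrite stieltjes_itv ?ltry.
by rewrite set_itv_ge ?measure0// bnd_simp -leNgt ltW.
Qed.

Lemma measurable_id_stieltjes (D : set (measurableTypeR R)) :
  measurable_fun D (idfun : measurableTypeR R -> R).
Proof. exact: (@measurable_id _ R D). Qed.

Lemma measurable_sqr_stieltjes (D : set (measurableTypeR R)) :
  measurable_fun D (fun t : measurableTypeR R => ((t : R) ^+ 2)%:E).
Proof.
by apply/measurable_EFinP; apply: measurable_funX; exact: measurable_id_stieltjes.
Qed.

(** [|t|] is dominated by [t ^+ 2] off [-1, 1], and a Stieltjes measure is
    finite on bounded intervals even if its total mass is infinite. *)
Lemma integrable_sqr_id : (\int[mu]_t (t ^+ 2)%:E < +oo)%E ->
  mu.-integrable setT (EFin \o (idfun : measurableTypeR R -> R)).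
Proof.
move=> sq.
have mI : measurable (`](- 2), 1]%classic : set (measurableTypeR R)).
  exact: measurable_itv.
(* ]-2, 1] is a half-open interval that contains [-1, 1]. *)
pose g (t : measurableTypeR R) : \bar R :=
  ((\1_`](- 2), 1]%classic t)%:E + ((t : R) ^+ 2)%:E)%E.
have := @le_integrable _ _ _ mu setT measurableT (EFin \o (idfun : measurableTypeR R -> R)) g.
apply.
- by apply/measurable_EFinP; exact: measurable_id_stieltjes.
- move=> t _ /=; rewrite lee_fin indicE.
  have t2 := sqr_ge0 (t : R).
  case: (boolP (t \in `](- 2), 1]%classic)) => [_|].
    rewrite [leRHS]ger0_norm ?addr_ge0//.
    have := sqr_ge0 ((t : R) + 1); have := sqr_ge0 ((t : R) - 1).
    rewrite sqrrB sqrrD expr1n !mulr1 ler_norml /=; lra.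
  rewrite notin_setE /= in_itv /= => /negP; rewrite negb_and -leNgt -ltNge => t12.
  rewrite add0r expr2 normrM ler_peMl//.
  by rewrite ler_normr; case/orP: t12 => t1; apply/orP; [right|left]; lra.
- apply: integrableD => //.
    apply/integrableP; split.
      by apply/measurable_EFinP; exact: measurable_indic.
    under eq_integral do rewrite gee0_abs ?lee_fin//.
    by rewrite integral_indic// setIT stieltjes_itv_lty.
  apply/integrableP; split; first exact: measurable_sqr_stieltjes.
  by under eq_integral do rewrite gee0_abs ?lee_fin ?sqr_ge0//.
Qed.

Lemma integrable_bounded_itv a b (g : measurableTypeR R -> R) :
  measurable_fun setT g -> [bounded g t | t in `]a, b]%classic] ->
  mu.-integrable `]a, b]%classic (EFin \o g).
Proof.
move=> mg bg; have mI : measurable (`]a, b]%classic : set (measurableTypeR R)).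
  exact: measurable_itv.
have := @measurable_bounded_integrable _ _ _ mu g _ mI; apply => //.
  exact: stieltjes_itv_lty.
by apply: measurable_funS mg.
Qed.

Section Concentrated.
Context (a b : R).
Hypotheses (ab : a <= b) (fa : forall t, t <= a -> f t = f a)
  (fb : forall t, b <= t -> f t = f b).

Let mI : measurable (`]a, b]%classic : set (measurableTypeR R)).
Proof. exact: measurable_itv. Qed.

Lemma stieltjes_sqr_lty : (\int[mu]_t (t ^+ 2)%:E < +oo)%E.
Proof.
rewrite (@ge0_negligible_integral _ _ _ mu setT (~` `]a, b]%classic))//.
- rewrite setDE setCK setTI.
  have : mu.-integrable `]a, b]%classic (EFin \o (fun t => t ^+ 2 : R)).
    apply: integrable_bounded_itv.
      by apply: measurable_funX; exact: measurable_id_stieltjes.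
    exists ((`|a| + `|b|) ^+ 2); split; first exact: num_real.
    move=> M abM t; rewrite /= in_itv/= => /andP[ta tb].
    rewrite normrX; apply: le_trans (ltW abM); rewrite lerXn2r ?nnegrE ?addr_ge0//.
    have := ler_norm b; have := ler_norm (- a); rewrite normrN ler_norml.
    by have := normr_ge0 a; have := normr_ge0 b; lra.
  move/integrableP => [_]; apply: le_lt_trans; apply: ge0_le_integral => //.
  - by move=> t _; rewrite lee_fin sqr_ge0.
  - exact: measurable_sqr_stieltjes.
  - by apply: measurableT_comp => //; exact: measurable_sqr_stieltjes.
  - by move=> t _; rewrite /= lee_fin ler_norm.
- exact: measurableC.
- exact: measurable_sqr_stieltjes.
- by move=> t _; rewrite lee_fin sqr_ge0.
- exact: stieltjes_null.
Qed.

Lemma stieltjes_integral_id_bounds :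
  a * (f b - f a) <= \int[mu]_t t <= b * (f b - f a).
Proof.
have intT := integrable_sqr_id stieltjes_sqr_lty.
have intI : mu.-integrable `]a, b]%classic (EFin \o (idfun : measurableTypeR R -> R)).
  by apply: integrableS intT.
have -> : \int[mu]_t t = \int[mu]_(t in `]a, b]%classic) t.
  rewrite /Rintegral (@negligible_integral _ _ _ mu setT (~` `]a, b]%classic))//.
  - by rewrite setDE setCK setTI.
  - exact: measurableC.
  - exact: stieltjes_null.
have cstE c : \int[mu]_(t in `]a, b]%classic) c = c * (f b - f a).
  have -> : f b - f a = fine (mu `]a, b]%classic) by rewrite stieltjes_itv.
  exact: Rintegral_cst.
have intc c : mu.-integrable `]a, b]%classic (EFin \o (fun=> c) : measurableTypeR R -> _).
  by apply: integrable_bounded_itv => //; exact: bounded_cst.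
rewrite -!cstE; apply/andP; split; apply: le_Rintegral => //= t;
  by rewrite /= in_itv/= => /andP[/ltW].
Qed.

End Concentrated.

End StieltjesIntegral.

Lemma stieltjes_integral_id_add {R : realType} (f g h : cumulative R R) :
  (forall t, f t = g t + h t) ->
  (\int[lebesgue_stieltjes_measure g]_t (t ^+ 2)%:E < +oo)%E ->
  (\int[lebesgue_stieltjes_measure h]_t (t ^+ 2)%:E < +oo)%E ->
  \int[lebesgue_stieltjes_measure f]_t t =
  \int[lebesgue_stieltjes_measure g]_t t + \int[lebesgue_stieltjes_measure h]_t t.
Proof.
move=> fE /integrable_sqr_id ig /integrable_sqr_id ih.
rewrite /Rintegral -fineD; [|exact: integrable_fin_num..].
congr fine; rewrite -integral_measure_add//.
by apply: eq_measure_integral => A mA _; exact: stieltjes_add.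
Qed.

(** * Spectral families and their bands *)

Section SpectralFamily.
Context {R : realType} {X : hilbertType R} (E : spectral_family X).
Implicit Types (u v : X) (a b s t : R).

Lemma sfD t u v : E t (u + v) = E t u + E t v.
Proof. by have := sf_linear E t 1 u v; rewrite !scale1r. Qed.

Lemma sf0 t : E t 0 = 0.
Proof. by apply/(addrI (E t 0)); rewrite -sfD !addr0. Qed.

Lemma sfN t u : E t (- u) = - E t u.
Proof. by have := sf_linear E t (-1) u 0; rewrite sf0 !addr0 !scaleN1r. Qed.

Lemma sfB t u v : E t (u - v) = E t u - E t v.
Proof. by rewrite sfD sfN. Qed.

Lemma sf_rsym t u v : rinner (E t u) v = rinner u (E t v).
Proof. by rewrite /rinner sf_sym. Qed.

Lemma eq_rinner u v : (forall w, rinner u w = rinner v w) -> u = v.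
Proof.
move=> uv; apply/eqP; rewrite -subr_eq0; apply/eqP/rnorm_eq0/eqP.
by rewrite -sqrf_eq0 -rinner_sqr rinnerDl rinnerNl uv subrr.
Qed.

(** The adjoint of the monotonicity relation [E t (E s u) = E s u]. *)
Lemma sf_mono_le s t u : s <= t -> E s (E t u) = E s u.
Proof. by move=> st; apply: eq_rinner => w; rewrite !sf_rsym sf_mono. Qed.

(** The range of the projection [E b - E a]; described by equations, it can be
    tested without solving for a preimage. *)
Definition band a b : set X := [set u | E b u = u /\ E a u = 0].

Lemma band_subspace a b : is_subspace (band a b).
Proof.
split; first by split; rewrite sf0.
by move=> c u v [ub ua] [vb va]; split; rewrite sf_linear ?ub ?ua ?vb ?va// scaler0 addr0.
Qed.

Lemma bandB a b u : a <= b -> band a b (E b u - E a u).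
Proof.
by move=> ab; split; rewrite sfB ?sf_idem; [rewrite sf_mono|rewrite sf_mono_le// subrr].
Qed.

Lemma band_le a b u t : band a b u -> t <= a -> E t u = 0.
Proof. by move=> [_ ua] ta; rewrite -(sf_mono_le u ta) ua sf0. Qed.

Lemma band_ge a b u t : band a b u -> b <= t -> E t u = u.
Proof. by move=> [ub _] bt; rewrite -ub sf_mono. Qed.

Lemma spectral_distE u t : spectral_dist E u t = rinner (E t u) u.
Proof. by []. Qed.

(** This and the next lemma let the band ]a, b] exhaust the real line. *)
Lemma sf_cvg_at_pinfty u b (e : R) : 0 < e ->
  exists2 t, b <= t & rnorm (u - E t u) < e.
Proof.
move=> e0; have ec : (0 : R[i]) < e%:C by rewrite ltcR.
have /cvgrPdist_lt/(_ _ ec) near1 := @sf_cvg_pinfty _ _ E u.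
have near2 : \forall t \near +oo, b <= t by exact: nbhs_pinfty_ge (num_real _).
have [t [h1 h2]] := @filter_ex _ _ _ _ (filterI near1 near2).
by exists t => //; rewrite -ltcR -rnormE.
Qed.

Lemma sf_cvg_at_ninfty u b (e : R) : 0 < e ->
  exists2 t, t <= b & rnorm (E t u) < e.
Proof.
move=> e0; have ec : (0 : R[i]) < e%:C by rewrite ltcR.
have /cvgrPdist_lt/(_ _ ec) near1 := @sf_cvg_ninfty _ _ E u.
have near2 : \forall t \near -oo, t <= b by exact: nbhs_ninfty_le (num_real _).
have [t [h1 h2]] := @filter_ex _ _ _ _ (filterI near1 near2).
by exists t => //; rewrite -ltcR -rnormE; move: h1; rewrite /= sub0r normrN.
Qed.

End SpectralFamily.

(** * Dense subspaces and selfadjoint operators *)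

Section Subspace.
Context {R : realType} {X : hilbertType R} (D : set X).
Hypothesis subD : is_subspace D.

Lemma subspaceD u v : D u -> D v -> D (u + v).
Proof. by move=> Du Dv; rewrite -(scale1r u); exact: subD.2. Qed.

Lemma subspaceZ a u : D u -> D (a *: u).
Proof. by move=> Du; rewrite -(addr0 (a *: u)); apply: subD.2 => //; exact: subD.1. Qed.

Lemma subspaceN u : D u -> D (- u).
Proof. by rewrite -scaleN1r; exact: subspaceZ. Qed.

Lemma subspaceB u v : D u -> D v -> D (u - v).
Proof. by move=> Du Dv; apply: subspaceD => //; exact: subspaceN. Qed.

(** Approximate [u] by [v] in [D] with [|u - v| < |u|]; then
    [|u|^2 = (u, u - v) < |u|^2] unless [u = 0]. *)
Lemma dense_orthogonal u : closure D = setT ->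
  (forall v, D v -> rinner u v = 0) -> u = 0.
Proof.
move=> dD uD; apply: rnorm_eq0; apply/eqP; rewrite -[_ == _]negbK; apply/negP => u0.
have {}u0 : 0 < rnorm u by rewrite lt_neqAle eq_sym u0 rnorm_ge0.
have : closure D u by rewrite dD.
move=> /(_ (ball u (rnorm u)%:C)) [|v [Dv]].
  by apply: nbhsx_ballx; rewrite ltcR.
rewrite -ball_normE /= rnormE ltcR => uv.
have := rinner_le u (u - v); rewrite rinnerDr rinnerNr (uD _ Dv) subr0 rinner_sqr.
by rewrite expr2 ler_pM2l// leNgt uv.
Qed.

End Subspace.

Section Operator.
Context {R : realType} {X : hilbertType R} (T : operator X).
Local Notation dsub := (dom_subspace T).

Lemma opD u v : dom T u -> dom T v -> T (u + v) = T u + T v.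
Proof. by move=> Du Dv; rewrite -[u]scale1r op_linear// !scale1r. Qed.

Lemma op0 : T 0 = 0.
Proof. by apply/(addrI (T 0)); rewrite -opD ?addr0//; exact: dsub.1. Qed.

Lemma opZ a u : dom T u -> T (a *: u) = a *: T u.
Proof.
by move=> Du; rewrite -[a *: u]addr0 op_linear ?op0 ?addr0//; exact: dsub.1.
Qed.

Lemma selfadjoint_sym : selfadjoint T ->
  forall u v, dom T u -> dom T v -> inner (T u) v = inner u (T v).
Proof.
by move=> [_ sa] u v Du Dv; have [_ /(_ (conj Dv erefl))] := sa v (T v); apply.
Qed.

Lemma selfadjoint_rsym : selfadjoint T ->
  forall u v, dom T u -> dom T v -> rinner (T u) v = rinner u (T v).
Proof. by move=> sa u v Du Dv; rewrite /rinner selfadjoint_sym. Qed.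

End Operator.

(** * Operators on the bands of their spectral family *)

Section SpectralOperator.
Context {R : realType} {X : hilbertType R} (T : operator X) (E : spectral_family X).
Hypotheses (sa : selfadjoint T) (TE : spectral_family_of E T).
Implicit Types (u v : X) (a b s t : R).
Local Notation dsub := (dom_subspace T).
Local Notation band := (band E).

Lemma rinner_op u : dom T u -> rinner (T u) u = \int[spectral_measure E u]_t t.
Proof. by move=> Du; rewrite /rinner TE.2. Qed.

Section Band.
Context (a b : R).
Hypothesis ab : a <= b.

Lemma band_dom u : band a b u -> dom T u.
Proof.
move=> Ku; rewrite TE.1; apply: (@stieltjes_sqr_lty _ _ a b) => t tab /=; rewrite !spectral_distE.
  by rewrite !(band_le Ku).
by rewrite !(band_ge Ku).
Qed.

(** The spectral measure of [u] is carried by ]a, b] and has mass [|u|^2]. *)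
Lemma band_bounds u : band a b u ->
  a * rnorm u ^+ 2 <= rinner (T u) u <= b * rnorm u ^+ 2.
Proof.
move=> Ku; have Du := band_dom Ku.
have -> : rnorm u ^+ 2 = spectral_dist E u b - spectral_dist E u a.
  by rewrite !spectral_distE Ku.1 Ku.2 rinner0l subr0 rinner_sqr.
rewrite rinner_op//; apply: stieltjes_integral_id_bounds => // t tab /=; rewrite !spectral_distE.
  by rewrite !(band_le Ku).
by rewrite !(band_ge Ku).
Qed.

Lemma band_sf u t : band a b u -> band a b (E t u).
Proof.
move=> Ku; split.
  have [tb|/ltW bt] := leP t b; first by rewrite sf_mono.
  by rewrite (band_ge Ku bt) Ku.1.
have [ta|/ltW at'] := leP t a; first by rewrite (band_le Ku ta) sf0.
by rewrite sf_mono_le// Ku.2.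
Qed.

Lemma band_orth u v : band a b u -> E b v = E a v -> rinner u v = 0.
Proof.
move=> [ub ua] vab.
by rewrite -ub sf_rsym vab -sf_rsym ua rinner0l.
Qed.

(** The spectral distribution of [u + v] is the sum of those of [u] and [v],
    because [E t u] stays in the band and is thus orthogonal to [v].  So the
    quadratic form of [T] is additive on [u] and [v], and its cross term
    [2 Re (T u, v)] vanishes. *)
Lemma band_op_orth u v : band a b u -> dom T v -> E b v = E a v ->
  rinner (T u) v = 0.
Proof.
move=> Ku Dv vab; have Du := band_dom Ku.
have Duv := subspaceD dsub Du Dv.
have : rinner (T (u + v)) (u + v) = rinner (T u) u + rinner (T v) v.
  rewrite !rinner_op//; apply: stieltjes_integral_id_add.
  - move=> t /=; rewrite !spectral_distE sfD !rinnerE.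
    rewrite (sf_rsym E t v u) (rinnerC v) (band_orth (band_sf t Ku) vab).
    by rewrite add0r addr0.
  - by move: Du; rewrite TE.1.
  - by move: Dv; rewrite TE.1.
rewrite opD// !rinnerE (selfadjoint_rsym sa Dv Du) (rinnerC v) => /eqP.
by rewrite -subr_eq0 => /eqP; lra.
Qed.

(** The component of [T u] orthogonal to the band is orthogonal to the domain:
    pairing it with [v] amounts to pairing [T u] with the component of [v]
    orthogonal to the band, which is again in the domain. *)
Lemma band_op u : band a b u -> band a b (T u).
Proof.
move=> Ku; suff -> : T u = E b (T u) - E a (T u) by exact: bandB.
apply/eqP; rewrite -subr_eq0; apply/eqP; apply: (dense_orthogonal sa.1) => v Dv.
transitivity (rinner (T u) (v - (E b v - E a v))).
  by rewrite !rinnerE !sf_rsym.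
apply: band_op_orth => //.
  by apply: (subspaceB dsub) => //; apply: band_dom; exact: bandB.
rewrite !sfB !sf_idem (sf_mono E v ab) (sf_mono_le E v ab) subrr subr0.
by rewrite opprB addrC subrK.
Qed.

End Band.

End SpectralOperator.

(** * Norm bounds and spectral gaps *)

(** Polarization: for [v = c^-1 B u],
    [4 Re (B u, v) = (B (u + v), u + v) - (B (u - v), u - v)
       <= 2 c (|u|^2 + |v|^2)],
    and the left-hand side is [4 c^-1 |B u|^2]. *)
Lemma symmetric_norm_le {R : realType} {X : hilbertType R} (K : set X)
    (B : X -> X) (c : R) :
  is_subspace K ->
  (forall u v, K u -> K v -> B (u + v) = B u + B v) ->
  (forall (a : R) u, K u -> B (a%:C *: u) = a%:C *: B u) ->
  (forall u, K u -> K (B u)) ->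
  (forall u v, K u -> K v -> rinner (B u) v = rinner u (B v)) ->
  0 < c -> (forall u, K u -> `|rinner (B u) u| <= c * rnorm u ^+ 2) ->
  forall u, K u -> rnorm (B u) <= c * rnorm u.
Proof.
move=> subK BD BZ KB Bsym c0 Bc u Ku; set r := c^-1.
have r0 : 0 < r by rewrite invr_gt0.
have Kv := subspaceZ subK r%:C (KB _ Ku); set v := r%:C *: B u in Kv.
have nv : rnorm v = r * rnorm (B u) by rewrite rnormZ gtr0_norm.
have Buv : rinner (B u) v = r * rnorm (B u) ^+ 2 by rewrite rinnerZr rinner_sqr.
(* [v] has to be opaque, lest the bilinear expansion below unfold it. *)
clearbody v.
have Kw := subspaceZ subK ((-1 : R)%:C) Kv.
have := Bc _ (subspaceD subK Ku Kv); have := Bc _ (subspaceD subK Ku Kw).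
rewrite !BD// (BZ _ _ Kv) -!rinner_sqr !rinnerE (Bsym _ _ Kv Ku).
rewrite (rinnerC v (B u)) (rinnerC v u) !rinner_sqr nv.
rewrite Buv !ler_norml => /andP[lo _] /andP[_ hi].
have /(ler_wpM2l (ltW c0)) : 4 * (r * rnorm (B u) ^+ 2) <=
    2 * c * (rnorm u ^+ 2 + (r * rnorm (B u)) ^+ 2) by lra.
have cr : c * r = 1 by rewrite mulfV// gt_eqF.
have -> : c * (4 * (r * rnorm (B u) ^+ 2)) = 4 * (c * r) * rnorm (B u) ^+ 2 by ring.
have -> : c * (2 * c * (rnorm u ^+ 2 + (r * rnorm (B u)) ^+ 2)) =
  2 * ((c * rnorm u) ^+ 2 + ((c * r) * rnorm (B u)) ^+ 2) by ring.
rewrite cr !mul1r mulr1 => le4.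
rewrite -(@ler_pXn2r _ 2)// ?nnegrE ?mulr_ge0 ?rnorm_ge0 ?(ltW c0)//; lra.
Qed.

Section SpectralGap.
Context {R : realType} {X : hilbertType R} (T : operator X) (E : spectral_family X).
Hypotheses (sa : selfadjoint T) (TE : spectral_family_of E T).
Implicit Types (u v : X) (a b c s t : R).
Local Notation dsub := (dom_subspace T).
Local Notation band := (band E).

Lemma band_shift_norm_le a b c d : a <= b -> 0 < d ->
  (forall u, band a b u ->
    `|rinner (T u) u - c * rnorm u ^+ 2| <= d * rnorm u ^+ 2) ->
  forall u, band a b u -> rnorm (T u - c%:C *: u) <= d * rnorm u.
Proof.
move=> ab d0 Tcd; have subK := band_subspace E a b.
apply: symmetric_norm_le => //.
- move=> u v /(band_dom TE) Du /(band_dom TE) Dv.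
  by rewrite (opD Du Dv) scalerDr opprD addrACA.
- move=> e u /(band_dom TE) Du.
  by rewrite (opZ _ Du) scalerBr !scalerA mulrC.
- move=> u Ku; apply: (subspaceB subK); first exact: (band_op sa TE ab).
  exact: (subspaceZ subK).
- move=> u v /(band_dom TE) Du /(band_dom TE) Dv.
  by rewrite !rinnerE (selfadjoint_rsym sa).
- by move=> u Ku; rewrite !rinnerE rinner_sqr; exact: Tcd.
Qed.

Lemma continuous_linear_rnorm_le (A : {linear X -> X}) : continuous A ->
  exists2 c : R, 0 < c & forall v, rnorm (A v) <= c * rnorm v.
Proof.
move=> /linear_bounded_continuous/linear_boundedP [M [Mr Mle]].
exists (`|complex.Re M| + 1) => [|v]; first by rewrite ltr_wpDl.
rewrite -lecR rmorphM /= -!rnormE; apply: Mle.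
rewrite -(RRe_real Mr) ltcR ltr_pwDr//; exact: ler_norm.
Qed.

(** On a band around [t] of half-width [e] one has [|(T - t) v| <= e |v|].  If
    the resolvent at [t] has norm at most [c], then [|v| <= c e |v|], so the
    band is trivial as soon as [c e < 1]. *)
Lemma resolvent_locally_constant t : resolvent_set T t%:C ->
  exists2 e, 0 < e &
    forall s u, t - e <= s <= t + e -> E s u = E t u.
Proof.
move=> [A [/continuous_linear_rnorm_le[c c0 Ac] _ AT]].
(* This choice makes [c * e] equal to 1/2. *)
pose e := (2 * c)^-1; have e0 : 0 < e by rewrite invr_gt0 mulr_gt0.
have tee : t - e <= t + e by lra.
exists e => // s u st.
have K0 v : band (t - e) (t + e) v -> v = 0.
  move=> Kv; have /= := @band_shift_norm_le (t - e) (t + e) t e tee e0 _ v Kv.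
  have Tb w : band (t - e) (t + e) w ->
      `|rinner (T w) w - t * rnorm w ^+ 2| <= e * rnorm w ^+ 2.
    move=> Kw; have := band_bounds TE tee Kw; rewrite ler_norml => /andP[lo hi].
    by rewrite mulrBl mulrDl in lo hi *; apply/andP; split; lra.
  move=> /(_ Tb) Tv; have := Ac (T v - t%:C *: v); rewrite AT; last exact: band_dom Kv.
  move=> /le_trans/(_ (ler_wpM2l (ltW c0) Tv)); rewrite mulrA.
  have -> : c * e = 2^-1 by rewrite /e invfM mulrCA mulfV ?mulr1// gt_eqF.
  by have := rnorm_ge0 v => v0 v1; apply: rnorm_eq0; lra.
have Ete : E (t + e) u = E (t - e) u.
  by apply/eqP; rewrite -subr_eq0; apply/eqP/K0/bandB.
have Er r : t - e <= r <= t + e -> E r u = E (t - e) u.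
  by move=> /andP[r1 r2]; rewrite -(sf_mono_le E u r2) Ete sf_mono.
by rewrite !Er//; apply/andP; split; lra.
Qed.

(** The set of [t] in [a, b] with [E t u = E a u] contains its supremum and,
    by local constancy, cannot end before [b]. *)
Lemma resolvent_constant a b : a <= b ->
  (forall t, a <= t <= b -> resolvent_set T t%:C) ->
  forall u, E a u = E b u.
Proof.
move=> ab res u; pose S := [set t | a <= t <= b /\ E t u = E a u].
have Sa : S a by split=> //; rewrite lexx.
have supS : has_sup S.
  by split; [exists a|exists b => t [/andP[]]].
have sS t : S t -> t <= sup S by move=> St; exact: sup_ubound supS.2 _ St.
have sab : a <= sup S <= b.
  rewrite sS//=; apply: ge_sup; first exact: supS.1.
  by move=> t [/andP[]].
have [e e0 Ee] := resolvent_locally_constant (res _ sab).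
have [r Sr ser] := sup_adherent e0 supS.
have Es : E (sup S) u = E a u.
  by rewrite -Sr.2 Ee//; have := sS _ Sr => rs; apply/andP; split; lra.
have [bs|sb] := leP b (sup S + e).
  by rewrite -Es -(Ee b)//; case/andP: sab => _ sb; apply/andP; split; lra.
exfalso; suff /sS : S (sup S + e) by lra.
split; first by case/andP: sab => *; apply/andP; split; lra.
by rewrite -Es Ee//; apply/andP; split; lra.
Qed.

(** On the band [1 - b^-1 T] has norm at most [1 - a / b < 1].  Replacing [w] by
    [w + b^-1 (v - T w)] applies it to the residual [v - T w]; the vectors [w]
    are the partial sums of the Neumann series of [T^-1 v]. *)
Lemma band_op_range_dense a b v : 0 < a -> a < b -> band a b v ->
  forall n, exists2 w, band a b w &
    rnorm (v - T w) <= (1 - a / b) ^+ n * rnorm v.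
Proof.
move=> a0 ab Kv; have b0 := lt_trans a0 ab.
have subK := band_subspace E a b.
have res u : band a b u -> rnorm (u - b^-1%:C *: T u) <= (1 - a / b) * rnorm u.
  move=> Ku; have := @band_shift_norm_le a b b (b - a) (ltW ab) _ _ u Ku.
  rewrite subr_gt0 => /(_ ab) le1.
  have -> : u - b^-1%:C *: T u = (- b^-1)%:C *: (T u - b%:C *: u).
    rewrite scalerBr scalerA -rmorphM /= mulNr mulVf ?gt_eqF// !rmorphN /= !scaleNr.
    by rewrite scale1r opprK addrC.
  rewrite rnormZ normrN gtr0_norm ?invr_gt0//.
  have -> : 1 - a / b = b^-1 * (b - a) by rewrite mulrBr mulVf ?gt_eqF// mulrC.
  rewrite -mulrA ler_pM2l ?invr_gt0//; apply: le1 => w Kw.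
  have /andP[lo hi] := band_bounds TE (ltW ab) Kw.
  by rewrite mulrBl ler_norml; apply/andP; split; lra.
elim=> [|n [w Kw wn]].
  exists 0; first exact: subK.1.
  by rewrite op0 subr0 mul1r.
have Kr : band a b (v - T w).
  by apply: (subspaceB subK) => //; exact: (band_op sa TE (ltW ab)).
have Kbr := subspaceZ subK b^-1%:C Kr.
exists (w + b^-1%:C *: (v - T w)); first exact: (subspaceD subK).
rewrite (opD (band_dom TE Kw) (band_dom TE Kbr)) (opZ _ (band_dom TE Kr)).
rewrite opprD addrA; apply: le_trans (res _ Kr) _.
rewrite exprS -mulrA ler_wpM2l// subr_ge0 ler_pdivrMr// mul1r; exact: ltW.
Qed.

End SpectralGap.

(** * Operators of forms *)

Section FormOperator.
Context {R : realType} {X : hilbertType R} (Q : set X) (h : X -> X -> R[i])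
  (T : operator X).
Hypothesis hT : operator_of_form Q h T.

Lemma form_dom u : dom T u -> Q u.
Proof. by case: hT => _ [S [[_ _ -> _] <- _]] []. Qed.

(** If [S] is the square root of [T], then
    [h(u, v) = (S u, S v) = (S (S u), v) = (T u, v)]. *)
Lemma form_opl u v : dom T u -> Q v -> complex.Re (h u v) = rinner (T u) v.
Proof.
move=> Du Qv; have Qu := form_dom Du.
case: hT => _ [S [[Ssa _ domT TS] SQ hS]].
have [Su SSu] : dom S u /\ dom S (S u) by move: (Du); rewrite domT.
by rewrite hS// TS// (selfadjoint_rsym Ssa SSu)// SQ.
Qed.

Lemma form_opr u v : Q u -> dom T v -> complex.Re (h u v) = rinner u (T v).
Proof.
move=> Qu Dv; have Qv := form_dom Dv.
case: hT => _ [S [[Ssa _ domT TS] SQ hS]].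
have [Sv SSv] : dom S v /\ dom S (S v) by move: (Dv); rewrite domT.
by rewrite hS// TS// -(selfadjoint_rsym Ssa _ SSv)// SQ.
Qed.

Lemma form_op_ge0 u : dom T u -> 0 <= rinner (T u) u.
Proof.
move=> Du; rewrite -form_opl//; last exact: form_dom.
have Qu := form_dom Du; case: hT => _ [S [_ _ ->]]//.
by rewrite -/(rinner _ _) rinner_sqr sqr_ge0.
Qed.

End FormOperator.

Lemma ler_geometric {R : realType} (q x y z : R) : 0 <= q < 1 ->
  (forall n, x <= y + q ^+ n * z) -> x <= y.
Proof.
move=> /andP[q0 q1] xyz.
have : (fun n => y + q ^+ n * z) @ \oo --> y + 0 * z.
  apply: cvgD; first exact: cvg_cst.
  apply: cvgM; last exact: cvg_cst.
  by apply: cvg_expr; rewrite ger0_norm.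
rewrite mul0r addr0 => ylim; rewrite -(cvg_lim _ ylim)//.
apply: limr_ge; first by apply/cvg_ex; exists y.
by near=> n.
Unshelve. all: by end_near. Qed.

(** * The difference of two spectral projections *)

Section Projections.
Context {R : realType} {X : hilbertType R}.
Implicit Types (E F : spectral_family X).

Lemma rnorm_sqr_sf E t (x : X) :
  rnorm x ^+ 2 = rnorm (E t x) ^+ 2 + rnorm (x - E t x) ^+ 2.
Proof.
rewrite -!rinner_sqr !rinnerE (rinnerC x (E t x)).
by rewrite (sf_rsym E t x (E t x)) sf_idem (rinnerC x (E t x)); ring.
Qed.

Lemma rnorm_sf E t (x : X) : rnorm (E t x) <= rnorm x.
Proof.
rewrite -(@ler_pXn2r _ 2)// ?nnegrE ?rnorm_ge0// (rnorm_sqr_sf E t x).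
by rewrite lerDl sqr_ge0.
Qed.

Lemma rnorm_sf_compl E t (x : X) : rnorm (x - E t x) <= rnorm x.
Proof.
rewrite -(@ler_pXn2r _ 2)// ?nnegrE ?rnorm_ge0// (rnorm_sqr_sf E t x).
by rewrite lerDr sqr_ge0.
Qed.

(** With projections [p = F t] and [q = E t], write
    [p x - q x = p (x - q x) - (q x - p q x)].  The two terms are orthogonal;
    each hypothesis bounds one of them, by [d |x - q x|] and [d |q x|], and the
    squares of these add up to [d^2 |x|^2]. *)
Lemma rnorm_sfB E F t (d : R) : 0 <= d ->
  (forall u v, E t u = u -> F t v = 0 -> rinner u v <= d * (rnorm u * rnorm v)) ->
  (forall u v, F t u = u -> E t v = 0 -> rinner u v <= d * (rnorm u * rnorm v)) ->
  forall x, rnorm (F t x - E t x) <= d * rnorm x.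
Proof.
move=> d0 EF FE x; set y := E t x; pose v := F t (x - y); pose w := y - F t y.
have -> : F t x - y = v - w by rewrite /v /w sfB opprB addrA subrK.
have le_of_sqr (p q : R) : 0 <= p -> 0 <= q -> p ^+ 2 <= d * (q * p) -> p <= d * q.
  move=> p0 q0; rewrite expr2 mulrA; have [->|p1] := eqVneq p 0.
    by rewrite mulr_ge0.
  by rewrite ler_pM2r// lt_neqAle eq_sym p1.
have vle : rnorm v <= d * rnorm (x - y).
  apply: le_of_sqr; rewrite ?rnorm_ge0// -rinner_sqr {2}/v -sf_rsym /v sf_idem mulrC.
  rewrite -/v -mulrC (mulrC (rnorm (x - y))); apply: FE; rewrite ?sf_idem//.
  by rewrite sfB sf_idem subrr.
have wle : rnorm w <= d * rnorm y.
  apply: le_of_sqr; rewrite ?rnorm_ge0//.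
  have Fw : F t w = 0 by rewrite /w sfB sf_idem subrr.
  have -> : rnorm w ^+ 2 = rinner y w.
    by rewrite -rinner_sqr {1}/w rinnerDl rinnerNl sf_rsym Fw (rinnerC y 0) rinner0l subr0.
  by apply: EF => //; rewrite sf_idem.
have vw : rinner v w = 0.
  by rewrite sf_rsym /w sfB sf_idem subrr rinnerC rinner0l.
clearbody v w; rewrite -(@ler_pXn2r _ 2)// ?nnegrE ?mulr_ge0 ?rnorm_ge0//.
rewrite exprMn (rnorm_sqr_sf E t x) -/y mulrDr -!exprMn.
rewrite -rinner_sqr !rinnerE (rinnerC w) vw !rinner_sqr oppr0 add0r addr0 opprK addrC.
by rewrite lerD// lerXn2r// nnegrE ?mulr_ge0 ?rnorm_ge0.
Qed.

End Projections.

(** * The angle between the spectral subspaces *)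

Section Angle.
Context {R : realType} {X : hilbertType R} (Q : set X) (h m : X -> X -> R[i])
  (H M : operator X) (EH EM : spectral_family X) (eta D1 D2 : R).
Hypotheses (hH : operator_of_form Q h H) (mM : operator_of_form Q m M)
  (EHH : spectral_family_of EH H) (EMM : spectral_family_of EM M)
  (eta0 : 0 <= eta) (D10 : 0 < D1) (D12 : D1 < D2).
Hypothesis hm : forall u v, Q u -> Q v ->
  `|complex.Re (h u v) - complex.Re (m u v)|
    <= eta * Num.sqrt (qform h u * qform m v).

Let delta := Num.sqrt (D2 * D1) / (D2 - D1) * eta.

Let D20 : 0 < D2. Proof. exact: lt_trans D12. Qed.

(** The form [h] is nonnegative, so the bound does not depend on the lower end
    [a] of the band. *)
Lemma band_op_norm_le a u : a <= D1 -> band EH a D1 u ->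
  rnorm (H u) <= D1 * rnorm u.
Proof.
move=> aD Ku; have [saH _] := hH.
have := band_shift_norm_le saH EHH (c := 0) aD D10 _ Ku.
rewrite scale0r subr0; apply => w Kw; rewrite mul0r subr0.
have /andP[_ hi] := band_bounds EHH aD Kw.
by rewrite ger0_norm//; apply: (form_op_ge0 hH); exact: band_dom EHH _ _ _ Kw.
Qed.

Lemma band_op_norm_ge b w : D2 <= b -> band EM D2 b w ->
  D2 * rnorm w <= rnorm (M w).
Proof.
move=> Db Kw; have /andP[lo _] := band_bounds EMM Db Kw.
have := le_trans lo (rinner_le (M w) w); rewrite expr2 mulrA.
have [->|w0] := eqVneq (rnorm w) 0; first by rewrite !mulr0 rnorm_ge0.
by have wp : 0 < rnorm w; [rewrite lt_neqAle eq_sym w0 rnorm_ge0|rewrite ler_pM2r].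
Qed.

(** The improvement of an angle bound by one use of
    [(u, M w) = (H u, w) + (m - h)(u, w)]; the vectors [M w] come close to any
    vector of the band. *)
Lemma band_angle_improve a b (tau : R) : a <= D1 -> D2 < b -> 0 <= tau ->
  (forall u w, band EH a D1 u -> band EM D2 b w ->
     rinner u w <= tau * (rnorm u * rnorm w)) ->
  forall u v, band EH a D1 u -> band EM D2 b v ->
    rinner u v <= (tau * (D1 / D2) + eta * (Num.sqrt (D2 * D1) / D2))
      * (rnorm u * rnorm v).
Proof.
move=> aD Db tau0 le_tau u v Ku Kv; set k := (_ + _).
have k0 : 0 <= k.
  by rewrite addr_ge0 ?mulr_ge0 ?invr_ge0 ?sqrtr_ge0 ?(ltW D10) ?(ltW D20).
have [saM _] := mM; have [saH _] := hH.
have DHu := band_dom EHH Ku; have Qu := form_dom hH DHu.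
have main w : band EM D2 b w -> rinner u (M w) <= k * (rnorm u * rnorm (M w)).
  move=> Kw; have DMw := band_dom EMM Kw; have Qw := form_dom mM DMw.
  have nw := band_op_norm_ge (ltW Db) Kw.
  have {}nw : rnorm w <= rnorm (M w) / D2 by rewrite ler_pdivlMr// mulrC.
  have nu := band_op_norm_le aD Ku.
  have := hm Qu Qw; rewrite (form_opl hH DHu Qw) (form_opr mM Qu DMw).
  rewrite distrC ler_norml => /andP[_ ].
  have sq : Num.sqrt (qform h u * qform m w) <=
      Num.sqrt (D2 * D1) / D2 * (rnorm u * rnorm (M w)).
    set s := Num.sqrt (D2 * D1); have s0 : 0 <= s := sqrtr_ge0 _.
    have rhs0 : 0 <= s / D2 * (rnorm u * rnorm (M w)).
      by rewrite !mulr_ge0 ?rnorm_ge0 ?invr_ge0 ?(ltW D20).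
    rewrite -[leRHS](ger0_norm rhs0) -sqrtr_sqr ler_wsqrtr//.
    have -> : (s / D2 * (rnorm u * rnorm (M w))) ^+ 2 =
        (D1 * rnorm u ^+ 2) * (rnorm (M w) * (rnorm (M w) / D2)).
      rewrite !exprMn sqr_sqrtr ?mulr_ge0 ?(ltW D20) ?(ltW D10)//.
      by field; rewrite gt_eqF.
    rewrite /qform (form_opl hH DHu Qu) (form_opl mM DMw Qw).
    have /andP[_ hu] := band_bounds EHH aD Ku.
    rewrite ler_pM ?(form_op_ge0 hH) ?(form_op_ge0 mM)//.
    by apply: le_trans (rinner_le _ _) _; rewrite ler_wpM2l ?rnorm_ge0.
  have huw : rinner (H u) w <= tau * (D1 / D2) * (rnorm u * rnorm (M w)).
    apply: le_trans (le_tau _ _ (band_op saH EHH aD Ku) Kw) _.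
    have -> : tau * (D1 / D2) * (rnorm u * rnorm (M w)) =
      tau * ((D1 * rnorm u) * (rnorm (M w) / D2)) by ring.
    by rewrite ler_wpM2l// ler_pM ?rnorm_ge0.
  have := ler_wpM2l eta0 sq; rewrite /k mulrDl -(mulrA eta); lra.
have q01 : 0 <= 1 - D2 / b < 1.
  have b0 := lt_trans D20 Db.
  by rewrite subr_ge0 ler_pdivrMr// mul1r (ltW Db)/= ltrBlDr ltrDl divr_gt0.
apply: (ler_geometric (z := (k + 1) * (rnorm u * rnorm v)) q01) => n.
have [w Kw wn] := band_op_range_dense saM EMM D20 Db Kv n.
have {main} := main _ Kw; have := rinner_le u (v - M w).
rewrite rinnerDr rinnerNr; set qn := (1 - D2 / b) ^+ n in wn *.
have Mwn : rnorm (M w) <= rnorm v + qn * rnorm v.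
  have := rnormD v (- (v - M w)); rewrite rnormN opprB addrCA subrr addr0 => /le_trans; apply.
  by rewrite lerD2l.
have := ler_wpM2l (rnorm_ge0 u) wn.
have := ler_wpM2l k0 (ler_wpM2l (rnorm_ge0 u) Mwn).
lra.
Qed.

Let delta0 : 0 <= delta.
Proof. by rewrite /delta !mulr_ge0 ?sqrtr_ge0// invr_ge0 subr_ge0 ltW. Qed.

(** [delta] is the fixed point of the improvement step, so starting from
    [delta + 1] the excess over [delta] shrinks by the factor [D1 / D2]. *)
Lemma band_angle a b u v : a <= D1 -> D2 < b -> band EH a D1 u -> band EM D2 b v ->
  rinner u v <= delta * (rnorm u * rnorm v).
Proof.
move=> aD Db Ku Kv.
have r01 : 0 <= D1 / D2 < 1 by rewrite divr_ge0 ?ltW//= ltr_pdivrMr// mul1r.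
have fixd : delta * (D1 / D2) + eta * (Num.sqrt (D2 * D1) / D2) = delta.
  by rewrite /delta; field; rewrite subr_eq0 !gt_eqF.
apply: (ler_geometric (z := rnorm u * rnorm v) r01) => n.
rewrite -mulrDl; elim: n u v Ku Kv => [|n IH] u v Ku Kv.
  rewrite expr0 mulrDl mul1r; apply: le_trans (rinner_le _ _) _.
  by rewrite lerDr mulr_ge0// mulr_ge0 ?rnorm_ge0.
have -> : delta + (D1 / D2) ^+ n.+1 =
    (delta + (D1 / D2) ^+ n) * (D1 / D2) + eta * (Num.sqrt (D2 * D1) / D2).
  by rewrite mulrDl addrAC fixd exprSr.
apply: band_angle_improve Ku Kv => //; rewrite addr_ge0// exprn_ge0//.
by case/andP: r01.
Qed.

(** Cut [u] off at a low [a] and [v] at a high [b].  The spectral gap of [M]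
    places the cut-off of [v] in a band that starts at [D2] and not only at
    [D1]. *)
Lemma spectral_angle u v : EM D2 v = EM D1 v ->
  EH D1 u = u -> EM D1 v = 0 -> rinner u v <= delta * (rnorm u * rnorm v).
Proof.
move=> vD uD v0; apply/ler_addgt0Pr => e e0.
(* With cut-off errors below [e / c], the error in [rinner u v] is below [e];
   the summand 1 keeps [c] positive. *)
pose c := rnorm u + rnorm v + 1.
have c0 : 0 < c by rewrite ltr_wpDl// addr_ge0 ?rnorm_ge0.
have ec0 : 0 < e / c by rewrite divr_gt0.
have [a aD ua] := sf_cvg_at_ninfty EH u D1 ec0.
have [b Db vb] := sf_cvg_at_pinfty EM v (D2 + 1) ec0.
have {}Db : D2 < b by lra.
have Ku : band EH a D1 (u - EH a u) by rewrite -{1}uD; exact: bandB.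
have Kv : band EM D2 b (EM b v).
  by have := bandB EM v (ltW Db); rewrite vD v0 subr0.
have := band_angle aD Db Ku Kv.
have nu := rnorm_sf_compl EH a u; have nv := rnorm_sf EM b v.
have := ler_wpM2l delta0 (ler_pM (rnorm_ge0 _) (rnorm_ge0 _) nu nv) => h1 h2.
have := rinner_le (EH a u) (EM b v); have := rinner_le u (v - EM b v).
have := ler_pM (rnorm_ge0 _) (rnorm_ge0 _) (ltW ua) nv.
have := ler_wpM2l (rnorm_ge0 u) (ltW vb).
have : e / c * c = e by rewrite divfK// gt_eqF.
rewrite {2}/c !mulrDr mulr1 rinnerDl rinnerNl rinnerDr rinnerNr in h2 *.
rewrite (mulrC (rnorm u) (e / c)); lra.
Qed.

End Angle.

Theorem theorem3p2 (R : realType) (X : hilbertType R) (Q : set X)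
    (h m : X -> X -> R[i]) (H M : operator X) (EH EM : spectral_family X)
    (eta D1 D2 : R) :
  positive_definite_form Q h ->
  positive_definite_form Q m ->
  operator_of_form Q h H ->
  operator_of_form Q m M ->
  spectral_family_of EH H ->
  spectral_family_of EM M ->
  0 <= eta ->
  (forall phi psi, Q phi -> Q psi ->
     complex.Re `|h phi psi - m phi psi|
       <= eta * Num.sqrt (qform h phi * qform m psi)) ->
  0 < D1 -> D1 < D2 ->
  (forall t : R, D1 <= t <= D2 ->
     resolvent_set H t%:C /\ resolvent_set M t%:C) ->
  eta < (D2 - D1) / Num.sqrt (D2 * D1) ->
  (opnorm (EM D1 \- EH D1)%R
     <= (Num.sqrt (D2 * D1) / (D2 - D1) * eta)%:E)%E.
Proof.
move=> hpd mpd hH mM EHH EMM eta0 hm D10 D12 res _.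
have d0 : 0 <= Num.sqrt (D2 * D1) / (D2 - D1) * eta.
  by rewrite !mulr_ge0 ?sqrtr_ge0// invr_ge0 subr_ge0 ltW.
have hm_re u v : Q u -> Q v -> `|complex.Re (h u v) - complex.Re (m u v)|
    <= eta * Num.sqrt (qform h u * qform m v).
  move=> Qu Qv; apply: le_trans (hm _ _ Qu Qv).
  by rewrite -raddfB -lecR (RRe_real (normr_real _)) normc_ge_Re.
(* By the symmetry of the forms, the hypothesis is invariant under their
   exchange. *)
have mh_re u v : Q u -> Q v -> `|complex.Re (m u v) - complex.Re (h u v)|
    <= eta * Num.sqrt (qform m u * qform h v).
  move=> Qu Qv; have Re_conj (z : R[i]) : complex.Re (Num.conj z) = complex.Re z.
    by case: z.
  rewrite (pdf_symmetric hpd Qv Qu) (pdf_symmetric mpd Qv Qu) !Re_conj.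
  by rewrite distrC (mulrC (qform m u)); exact: hm_re.
have [saH _] := hH; have [saM _] := mM.
have gapH := resolvent_constant saH EHH (ltW D12) (fun t tD => (res t tD).1).
have gapM := resolvent_constant saM EMM (ltW D12) (fun t tD => (res t tD).2).
apply: ge_ereal_sup => _ [x /= x1 <-]; rewrite lee_fin.
apply: le_trans (_ : _ <= Num.sqrt (D2 * D1) / (D2 - D1) * eta * rnorm x) _.
  apply: rnorm_sfB => // u v uD v0.
    exact: (spectral_angle hH mM EHH EMM).
  exact: (spectral_angle mM hH EMM EHH).
by rewrite ler_piMr// -lecR -rnormE.
Qed.
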